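(* Let $\Gamma$ be a finite connected unoriented graph without loops (multiple edges allowed), with integer weights $\underline p=(p_i)_{i\in V(\Gamma)}$, $p_i\ge 0$. Put $q_i=v_i+2p_i-2$ and consider the system of equations in the unknowns $(\underline n,\underline e)\in\mathbb{N}^{V(\Gamma)}\times(\mathbb{N}^* )^{V(\Gamma)}$: $$ e_in_i=q_i+\sum_{j\in V(\Gamma),\,j\leftrightarrow i}e_{ij}n_j\qquad\text{for all } i\in V(\Gamma).\qquad (\ast)$$ Throughout, ''solution'' means a solution $(\underline n,\underline e)$ of $(\ast)$ such that $Q_{(\Gamma,\underline e)}$ is negative definite and there is no vertex $j$ with $p_j=0$ and $e_j=1$. Suppose that $(\Gamma,\underline p)$ is not a cusp-graph. Fix a vertex $i$ of $\Gamma$ and look at the possible values of $e_i$, when one varies $(\underline n,\underline e)$ among the solutions. Then: 1. If $v_i>1$, the number $e_i$ takes only a finite number of values. 2. If $v_i=1$, the number $e_i$ takes an infinite number of values if and only if there exists a solution with $n_i=0$. In this case, one obtains new solutions by varying only $e_i$ in $\mathbb{N}^*\setminus\{1\}$ and fixing all the other values of $(\underline n,\underline e)$.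
   Context: $\mathbb{N}=\{0,1,2,\dots\}$, $\mathbb{N}^*=\mathbb{N}\setminus\{0\}$. $V(\Gamma)$ is the vertex set of $\Gamma$. For distinct vertices $i,j$, $e_{ij}=e_{ji}\ge0$ is the number of edges between them, and $i\leftrightarrow j$ means $e_{ij}\ge 1$. The valency of $i$ is $v_i=\sum_{j\ne i}e_{ij}$. $(\Gamma,\underline p)$ is called a cusp-graph if $\Gamma$ is homeomorphic to a circle and $p_i=0$ for all $i\in V(\Gamma)$. For $\underline e\in(\mathbb{N}^* )^{V(\Gamma)}$, the quadratic form $Q_{(\Gamma,\underline e)}$ on $\mathbb{R}^{V(\Gamma)}$ is $Q_{(\Gamma,\underline e)}(\underline x)=\sum_{i}\big(-e_ix_i^2+\sum_{j\ne i}e_{ij}x_ix_j\big)$. The system $(\ast)$ is the system of adjunction formulae for the minimal resolution of a numerically Gorenstein normal surface singularity (not Du Val) with dual graph $\Gamma$, whose exceptional components $E_i$ have arithmetic genera $p_i$ and self-intersections $-e_i$, and whose anti-canonical cycle is $\sum_i (n_i+1)E_i$.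
   Formalization: In the last sentence of 2, the value of e_i giving p_j=0 and e_j=2 for all vertices j is excluded: there Q is never negative definite (e.g. affine D_4, reached from a leaf with e_i=3), so the claim as stated fails for that value. *)

(* Defs.v *)
From mathcomp Require Import all_boot all_order all_algebra.
From mathcomp Require Import all_classical all_reals all_analysis.

Set Implicit Arguments.
Unset Strict Implicit.
Unset Printing Implicit Defensive.

Import Order.TTheory GRing.Theory Num.Theory.
Import numFieldNormedType.Exports.

Local Open Scope classical_set_scope.
Local Open Scope ring_scope.

(* Having exactly two ends rules out loops; several edges may share their ends. *)
Record multigraph := Multigraph {
  vertex : finType;
  edge : finType;
  ends : edge -> {set vertex};
  card_ends : forall a, #|ends a| = 2%N }.

Section Graph.
Variable G : multigraph.
Implicit Types i j : vertex G.

Definition mult i j : nat := #|[set a : edge G | ends a == [set i; j]%SET]%SET|.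

Definition adj i j : bool := (1 <= mult i j)%N.

Definition valency i : nat := (\sum_(j | j != i) mult i j)%N.

Definition connected_graph : Prop := forall i j, connect adj i j.

End Graph.

Section Realization.
Variables (R : realType) (G : multigraph).

Definition vertex_point (i : vertex G) :
    'rV[R]_#|vertex G| * 'rV[R]_#|edge G| :=
  (delta_mx 0 (enum_rank i), 0).

(* An arc from i (t = 0) to j (t = 1). The coordinate t(1 - t) along the edge a
   makes distinct edges meet only at common ends; exchanging i and j amounts to
   replacing t by 1 - t, so no orientation of the edges is needed. *)
Definition edge_point (a : edge G) (i j : vertex G) (t : R) :
    'rV[R]_#|vertex G| * 'rV[R]_#|edge G| :=
  ((1 - t) *: delta_mx 0 (enum_rank i) + t *: delta_mx 0 (enum_rank j),
   (t * (1 - t)) *: delta_mx 0 (enum_rank a)).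

Definition realization : set ('rV[R]_#|vertex G| * 'rV[R]_#|edge G|) :=
  [set x | (exists i, x = vertex_point i) \/
           (exists a i j t, [/\ ends a = [set i; j]%SET, 0 <= t, t <= 1 &
                                x = edge_point a i j t])].

Definition circle : set (R * R) := [set z | z.1 ^+ 2 + z.2 ^+ 2 = 1].

End Realization.

Definition homeomorphic (X Y : topologicalType) (A : set X) (B : set Y) : Prop :=
  exists (f : X -> Y) (g : Y -> X),
    [/\ {within A, continuous f} /\ {within B, continuous g},
        (forall x, A x -> B (f x)) /\ (forall y, B y -> A (g y)),
        forall x, A x -> g (f x) = x &
        forall y, B y -> f (g y) = y].

Section Adjunction.
Variables (R : realType) (G : multigraph) (p : vertex G -> nat).
Implicit Types (n e : vertex G -> nat) (i j : vertex G).

Definition cusp_graph : Prop :=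
  homeomorphic (@realization R G) (@circle R) /\ forall i, p i = 0%N.

Definition Qform e (x : {ffun vertex G -> R}) : R :=
  \sum_i (- (e i)%:R * x i ^+ 2 + \sum_(j | j != i) (mult i j)%:R * x i * x j).

Definition negative_definite (Q : {ffun vertex G -> R} -> R) : Prop :=
  forall x, x != 0 -> Q x < 0.

Definition q i : int := (valency i)%:Z + 2 * (p i)%:Z - 2.

Definition adjunction_system n e : Prop :=
  forall i, (e i)%:Z * (n i)%:Z =
            q i + \sum_(j | adj j i) (mult i j)%:Z * (n j)%:Z.

Definition solution n e : Prop :=
  [/\ forall i, (0 < e i)%N,
      adjunction_system n e,
      negative_definite (Qform e) &
      ~ exists j, p j = 0%N /\ e j = 1%N].

Definition e_values i : set nat :=
  [set m | exists n e, solution n e /\ e i = m].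

(* The weights for which every component is a smooth rational (-2)-curve, as for
   Du Val singularities and for the (degenerate) affine Dynkin diagrams. *)
Definition du_val_weights e : Prop := forall j, p j = 0%N /\ e j = 2%N.

End Adjunction.

Definition update (T : eqType) (U : Type) (f : T -> U) (a : T) (b : U) : T -> U :=
  fun x => if x == a then b else f x.

(* Main.v *)
Require Import Defs.
From mathcomp Require Import all_boot all_order all_algebra.
From mathcomp Require Import all_classical all_reals all_analysis.
From mathcomp Require Import ring lra zify.

(* Write the system as [M n = q], where [M], the opposite of the intersection matrix, is a
   positive definite matrix with nonpositive off-diagonal entries; such a matrix
   has the property that [M z >= 0] implies [z >= 0].  Hence if [e <= e'] for two
   solutions [(n, e)] and [(n', e')], then [n' <= n].  If [e i] were unbounded, a
   sequence of solutions along which every [e j] is nondecreasing would have all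
   its [n] below the first one; the equation at [i] bounds [e i * n i], so
   eventually [n i = 0].
   If [n i = 0] and [v i > 1], the equation at [i] gives [v i = 2], [p i = 0] and
   [n j = 0] for the neighbours [j], which cannot be leaves for reasons of parity;
   by connectedness the graph is 2-regular, that is a circle, with [p = 0].
   If [n i = 0], changing [e i] preserves the system, and [n + 1] is a positive vector on
   which [M] is nonnegative and not zero, so the form stays negative definite. *)

Set Implicit Arguments.
Unset Strict Implicit.
Unset Printing Implicit Defensive.

Import Order.TTheory GRing.Theory Num.Theory.
Import numFieldNormedType.Exports.

Local Open Scope classical_set_scope.
Local Open Scope ring_scope.

(** * The intersection form *)

Lemma multC (G : multigraph) (i j : vertex G) : mult i j = mult j i.
Proof. by rewrite /mult finset.setUC. Qed.

Lemma mult_diag (G : multigraph) (i : vertex G) : mult i i = 0%N.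
Proof.
apply/eqP; rewrite cards_eq0 -finset.subset0; apply/fintype.subsetP => a.
by rewrite !inE => /eqP aii; have := card_ends a; rewrite aii finset.setUid cards1.
Qed.

Lemma adjC (G : multigraph) (i j : vertex G) : adj i j = adj j i.
Proof. by rewrite /adj multC. Qed.

(** [Qform] sums over [j != i] and the adjunction system over neighbours; both are normalised to
    sums over all vertices, the added multiplicities being zero. *)
Lemma sum_mult_neq (V : nmodType) (G : multigraph) (i : vertex G)
    (F : vertex G -> V) :
  \sum_(j | j != i) F j *+ mult i j = \sum_j F j *+ mult i j.
Proof.
by rewrite [RHS](bigD1 i) //= mult_diag mulr0n add0r.
Qed.

Lemma sum_mult_adj (V : nmodType) (G : multigraph) (i : vertex G)
    (F : vertex G -> V) :
  \sum_(j | adj j i) F j *+ mult i j = \sum_j F j *+ mult i j.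
Proof.
rewrite [RHS](bigID (fun j => adj j i)) /= [X in _ + X]big1 ?addr0 // => j.
by rewrite adjC /adj -eqn0Ngt => /eqP ->; rewrite mulr0n.
Qed.

Lemma valencyE (G : multigraph) (i : vertex G) :
  valency i = (\sum_j mult i j)%N.
Proof. by rewrite [RHS](bigD1 i) //= mult_diag add0n. Qed.

Section QuadraticForm.
Variables (R : realType) (G : multigraph).
Implicit Types (e n : vertex G -> nat) (x y z u : vertex G -> R) (i j : vertex G).

(** Row [i] of [M z], with [M] the opposite of the intersection matrix. *)
Definition intersection_opp e z i : R := (e i)%:R * z i - \sum_j z j *+ mult i j.

Lemma QformE e (x : {ffun vertex G -> R}) :
  Qform e x = - \sum_i x i * intersection_opp e x i.
Proof.
rewrite /Qform -sumrN; apply: eq_bigr => i _.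
rewrite /intersection_opp -sum_mult_neq mulrBr opprB addrC; congr (_ + _).
  by rewrite mulr_sumr; apply: eq_bigr => j _; rewrite -mulr_natr; ring.
by ring.
Qed.

(* Testing the form on the negative part of [z]. *)
Lemma intersection_opp_ge0 e z : negative_definite (@Qform R G e) ->
  (forall i, 0 <= intersection_opp e z i) -> forall i, 0 <= z i.
Proof.
move=> nd zge0.
pose y : {ffun vertex G -> R} := [ffun i => Num.max (- z i) 0].
have yge0 i : 0 <= y i by rewrite ffunE le_max lexx orbT.
have zy i : - z i <= y i by rewrite ffunE le_max lexx.
have yz i : y i * z i = - (y i * y i).
  by rewrite ffunE; case: (leP (- z i) 0); rewrite ?mul0r ?oppr0 // => _; ring.
have Qy : 0 <= Qform e y.
  rewrite QformE -sumrN; apply: sumr_ge0 => i _; rewrite -mulrN.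
  (* Since [y i * (y i + z i) = 0], the two sides differ by [y i] times the sum of the nonnegative
     terms [(y j + z j) *+ mult i j]. *)
  apply: (@le_trans _ _ (y i * intersection_opp e z i)); first exact: mulr_ge0.
  rewrite /intersection_opp opprB !mulrBr mulrCA yz mulrN mulrCA addrC lerD2r.
  rewrite -mulrN -sumrN ler_wpM2l//; apply: ler_sum => j _.
  by rewrite -mulNrn lerMn2r zy orbT.
have [y0|yn0] := eqVneq y 0; last by have := nd _ yn0; rewrite ltNge Qy.
by move=> i; have := zy i; rewrite y0 ffunE; lra.
Qed.

(* Putting [x = u y] turns [- 2 Q x] into a sum of squares. *)
Lemma negative_definite_of_supersolution e u : connected_graph G ->
  (forall i, 0 < u i) -> (forall i, 0 <= intersection_opp e u i) ->
  (exists i, intersection_opp e u i != 0) -> negative_definite (@Qform R G e).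
Proof.
move=> Gc u0 w0 [i0 wi0] x xn0.
pose y i := x i / u i.
have un0 i : u i != 0 by rewrite gt_eqF.
have xE i : x i = u i * y i by rewrite mulrC divfK.
clearbody y.
pose S := \sum_i \sum_j (u i * u j * (y i - y j) ^+ 2) *+ mult i j.
pose T := \sum_i intersection_opp e u i * u i * y i ^+ 2.
have QE : 2 * Qform e x = - (2 * T) - S.
  suff -> : S = 2 * (\sum_i \sum_j (u i * u j * (y i ^+ 2 - y i * y j)) *+ mult i j).
    rewrite QformE -mulrN -mulrBr; congr (_ * _).
    rewrite -!sumrN -big_split; apply: eq_bigr => i _ /=.
    have -> : \sum_j (u i * u j * (y i ^+ 2 - y i * y j)) *+ mult i j =
        u i * y i ^+ 2 * (\sum_j u j *+ mult i j) - x i * (\sum_j x j *+ mult i j).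
      rewrite !mulr_sumr -sumrB; apply: eq_bigr => j _.
      by rewrite xE (xE j); ring.
    by rewrite /intersection_opp; set s1 := \sum_j _; set s2 := \sum_j _; rewrite xE; ring.
  (* Symmetrisation: swapping the indices in one of the two copies turns [y i ^+ 2] into [y j ^+ 2],
     which completes the square. *)
  rewrite mulr_natl mulr2n {2}exchange_big -big_split; apply: eq_bigr => i _ /=.
  rewrite -big_split; apply: eq_bigr => j _ /=.
  by rewrite (multC j i) -mulrnDl; congr (_ *+ _); ring.
have Sterm i j : 0 <= (u i * u j * (y i - y j) ^+ 2) *+ mult i j.
  by rewrite mulrn_wge0 // mulr_ge0 ?sqr_ge0 // mulr_ge0 // ltW.
have Tterm i : 0 <= intersection_opp e u i * u i * y i ^+ 2.
  by rewrite mulr_ge0 ?sqr_ge0 // mulr_ge0 // ltW.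
have S0 : 0 <= S by apply: sumr_ge0 => i _; apply: sumr_ge0.
have T0 : 0 <= T by apply: sumr_ge0.
(* Only [T = S = 0] remains to be excluded: [T] gives [y i0 = 0], [S] makes [y] constant along
   edges, and connectedness then forces [x = 0]. *)
have [TS0|TSn0] := eqVneq (T + S) 0; last first.
  by have : 0 < T + S by [rewrite lt_def TSn0 addr_ge0]; lra.
have {TS0 S0 T0}[T0 S0] : T = 0 /\ S = 0 by lra.
have y0 : y i0 = 0.
  have /(_ i0 isT)/eqP := psumr_eq0P (fun i _ => Tterm i) T0.
  by rewrite !(mulf_eq0, expf_eq0) (negPf wi0) (negPf (un0 _)) /= orbb => /eqP.
have yadj i j : adj i j -> y i = y j.
  rewrite /adj => ij.
  have /(_ i isT) Si := psumr_eq0P (fun i _ => sumr_ge0 _ (fun j _ => Sterm i j)) S0.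
  have /(_ j isT)/eqP := psumr_eq0P (fun j _ => Sterm i j) Si.
  rewrite mulrn_eq0 eqn0Ngt ij /= !(mulf_eq0, expf_eq0) !(negPf (un0 _)) subr_eq0 /= orbb.
  by move=> /eqP.
have yz i : y i = 0.
  have /connectP[s + ->] := Gc i0 i.
  elim: s i0 {wi0} y0 => //= k s IH j yj /andP[/yadj jk ks].
  by apply: IH => //; rewrite -jk.
by case/eqP: xn0; apply/ffunP => i; rewrite ffunE xE yz mulr0.
Qed.

End QuadraticForm.

(** * Nondecreasing subsequences of families of natural numbers *)

Lemma nondecreasing_subsequence (u : nat -> nat) :
  exists2 f : nat -> nat, {homo f : k l / (k < l)%N} &
    {homo u \o f : k l / (k <= l)%N}.
Proof.
(* Each index of the subsequence minimises [u] on the tail starting just after the previous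
   index. *)
have argmin k : exists m, (k <= m)%N /\ forall l, (k <= l)%N -> (u m <= u l)%N.
  have ex : exists v, `[< exists2 m, (k <= m)%N & u m = v >].
    by exists (u k); apply/asboolP; exists k.
  case: (ex_minnP ex) => v /asboolP[m km <-] mmin; exists m; split=> // l kl.
  by apply: mmin; apply/asboolP; exists l.
have [g gP] := choice argmin.
pose f k := iter k (g \o S) (g 0%N).
have fS k : (f k < f k.+1)%N by have [] := gP (f k).+1.
exists f; first exact: (homo_ltn ltn_trans).
apply: homo_leq => [//|? ? ?|k /=]; first exact: leq_trans.
have fE : f k = g (if k is k'.+1 then (f k').+1 else 0%N) by case: k.
have [gk gmin] := gP (if k is k'.+1 then (f k').+1 else 0%N).
by rewrite {1}fE; apply: gmin; rewrite (leq_trans gk) // -fE ltnW.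
Qed.

(** Extraction is repeated over the finitely many [t]; each further extraction keeps the
    monotonicity already obtained. *)
Lemma nondecreasing_subsequence_fin (T : finType) (u : nat -> T -> nat) :
  exists2 f : nat -> nat, {homo f : k l / (k < l)%N} &
    forall t, {homo (fun k => u (f k) t) : k l / (k <= l)%N}.
Proof.
suff [f fi fP] : exists2 f : nat -> nat, {homo f : k l / (k < l)%N} &
    forall t, t \in enum T -> {homo (fun k => u (f k) t) : k l / (k <= l)%N}.
  by exists f => // t; apply: fP; rewrite mem_enum.
elim: (enum T) => [|t s [f fi fP]]; first by exists id.
have [g gi gP] := nondecreasing_subsequence (fun k => u (f k) t).
exists (f \o g) => [k l kl|t']; first exact/fi/gi.
rewrite inE => /predU1P[->//|/fP ft] k l kl; apply: ft.
by move: kl; rewrite leq_eqVlt => /predU1P[->//|/gi/ltnW].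
Qed.

(** * Solutions of the adjunction system *)

Section Solutions.
Variables (R : realType) (G : multigraph) (p : vertex G -> nat).
Implicit Types (e n : vertex G -> nat) (i j : vertex G).

Lemma adjunction_intersection n e i : adjunction_system p n e ->
  intersection_opp e (fun j => (n j)%:R) i = (q p i)%:~R :> R.
Proof.
move=> /(_ i) /(congr1 (intr : int -> R)).
rewrite rmorphM rmorphD /= rmorph_sum /= /intersection_opp -sum_mult_adj => ->.
apply/eqP; rewrite subr_eq; apply/eqP; congr (_ + _); apply: eq_bigr => j _.
by rewrite rmorphM /= -[RHS]mulr_natl.
Qed.

(** Both systems have the same [q], so [M0 (n0 - n)] has coordinates [(e i - e0 i) * n i], which are
    nonnegative. *)
Lemma adjunction_antitone n0 e0 n e : negative_definite (@Qform R G e0) ->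
  adjunction_system p n0 e0 -> adjunction_system p n e ->
  (forall i, (e0 i <= e i)%N) -> forall i, (n i <= n0 i)%N.
Proof.
move=> nd a0 a e0e i.
rewrite -(ler_nat R) -subr_ge0.
apply: (@intersection_opp_ge0 _ _ e0 (fun i => (n0 i)%:R - (n i)%:R)) => // {}i.
have := adjunction_intersection i a0; rewrite -(adjunction_intersection i a).
rewrite /intersection_opp.
under [X in _ -> _ <= _ - X]eq_bigr do rewrite mulrnBl.
rewrite sumrB; set s0 := \sum_j _; set s := \sum_j _ => ns.
have : 0 <= ((e i)%:R - (e0 i)%:R) * (n i)%:R :> R.
  by rewrite mulr_ge0 // subr_ge0 ler_nat.
by lra.
Qed.

Lemma infinite_e_values_zero i : infinite_set (e_values R p i) ->
  exists n e, solution R p n e /\ n i = 0%N.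
Proof.
move=> inf.
have large k : exists ne, solution R p ne.1 ne.2 /\ (k < ne.2 i)%N.
  apply: contrapT => small; apply: inf.
  apply: (@sub_finite_set _ _ `I_k.+1); last exact: finite_II.
  move=> m [n [e [sol <-]]] /=; rewrite ltnS leqNgt; apply/negP => km.
  by apply: small; exists (n, e).
have [ne neP] := choice large.
have [f fi fP] := nondecreasing_subsequence_fin (fun k => (ne k).2).
have [[_ a0 nd0 _] _] := neP (f 0%N).
(* [B] bounds the right-hand side at [i] for every later member of the subsequence, as their [n] lie
   below the first one. The member of index [f B] has [e i > f B >= B], which is impossible if [n i]
   is positive. *)
pose B := `|(q p i + \sum_(j | adj j i) (mult i j)%:Z * ((ne (f 0%N)).1 j)%:Z)%R|%N.
have [[epos a nd ne1] fBe] := neP (f B).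
exists (ne (f B)).1, (ne (f B)).2; split; first by split.
apply/eqP; rewrite -leqn0 leqNgt; apply/negP => nipos.
have nn0 := adjunction_antitone nd0 a0 a (fun j => fP j 0%N B (leq0n _)).
have Bf : (B <= f B)%N.
  by elim: B {fBe a nd ne1 epos nipos nn0} => // k kf; apply: leq_ltn_trans kf (fi _ _ _).
have : ((ne (f B)).2 i)%:Z <= B%:Z.
  apply: (@le_trans _ _ (((ne (f B)).2 i)%:Z * ((ne (f B)).1 i)%:Z)).
    by rewrite -PoszM lez_nat leq_pmulr.
  rewrite (a i) (le_trans _ (ler_norm _)) // lerD2l; apply: ler_sum => j _.
  by rewrite ler_wpM2l // lez_nat.
by rewrite lez_nat leqNgt (leq_ltn_trans Bf fBe).
Qed.

(** Moving the [- 2] of [q] across leaves natural numbers with total 2, hence very few cases. *)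
Lemma adjunction_zero n e i : adjunction_system p n e -> n i = 0%N ->
  (valency i + 2 * p i + \sum_j n j * mult i j = 2)%N.
Proof.
move=> /(_ i) a ni.
have E : \sum_(j | adj j i) (mult i j)%:Z * (n j)%:Z =
    Posz (\sum_j n j * mult i j)%N.
  rewrite -[RHS]natz natr_sum [LHS](eq_bigr (fun j => (n j)%:R *+ mult i j)).
    by rewrite sum_mult_adj; apply: eq_bigr => j _; rewrite natrM mulr_natr.
  by move=> j _; rewrite -[RHS]mulr_natl !natz.
move: a; rewrite ni mulr0 /q E => a.
have {}a : 0%:Z = (valency i)%:Z + 2 * (p i)%:Z - 2 +
  Posz (\sum_j n j * mult i j)%N := a.
by lia.
Qed.

Lemma zero_coefficient n e i : connected_graph G -> adjunction_system p n e ->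
  n i = 0%N -> (1 < valency i)%N -> forall j, valency j = 2%N /\ p j = 0%N.
Proof.
move=> Gc a.
have two j : n j = 0%N -> (1 < valency j)%N -> valency j = 2%N /\ p j = 0%N.
  by move=> nj; have := adjunction_zero a nj; lia.
(* The valency of [j] already exhausts the total 2, so [n] vanishes at each neighbour of [j]. *)
have step j k : adj j k -> n j = 0%N -> (1 < valency j)%N ->
    n k = 0%N /\ (1 < valency k)%N.
  move=> jk nj vj; have nk : n k = 0%N.
    have := adjunction_zero a nj; rewrite (bigD1 k) //=.
    by move: jk; rewrite /adj; case: (n k) => // m; case: (mult j k) => //; lia.
  split=> //; have := adjunction_zero a nk.
  rewrite (bigD1 j) //= nj mul0n add0n ltnNge.
  have kj : (0 < mult k j)%N by rewrite multC.
  (* Parity: if a single edge to [j] were the only edge at [k], the total at [k] would be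
     [1 + 2 * p k], which is not 2. *)
  rewrite valencyE (bigD1 j) //= => S2; apply/negP => v1.
  have /eqP : (\sum_(l | l != j) mult k l = 0)%N by lia.
  rewrite sum_nat_eq0 => /forallP m0.
  have : (\sum_(l | l != j) n l * mult k l = 0)%N.
    by apply: big1 => l lj; have := m0 l; rewrite lj => /eqP ->; rewrite muln0.
  by lia.
move=> ni vi j; suff [nj vj] : n j = 0%N /\ (1 < valency j)%N by exact: two.
have /connectP[s + ->] := Gc i j.
elim: s i ni vi => //= k s IH i ni vi /andP[ik ks].
by have [nk vk] := step _ _ ik ni vi; exact: IH.
Qed.

(* On [n + 1], a positive vector, the opposite of the intersection form takes the
   values [2 p k - 2 + e k], which are nonnegative and vanish only at rational
   (-2)-curves. *)
Lemma solution_update n e i m : connected_graph G -> solution R p n e ->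
  n i = 0%N -> (1 < m)%N -> ~ du_val_weights p (update e i m) ->
  solution R p n (update e i m).
Proof.
move=> Gc [epos a nd ne1] ni m1 ndv; set e' := update e i m.
have e'pos k : (0 < e' k)%N by rewrite /e' /update; case: eqP => // _; lia.
have a' : adjunction_system p n e'.
  move=> k; rewrite -a /e' /update; case: eqP => // ->.
  by rewrite ni !mulr0.
have ne1' : ~ exists j, p j = 0%N /\ e' j = 1%N.
  case=> j; rewrite /e' /update; case: eqP => [_ []|_ ?]; first by lia.
  by apply: ne1; exists j.
have w k : intersection_opp e' (fun j => (n j)%:R + 1) k =
    (2 * (p k)%:Z - 2 + (e' k)%:Z)%:~R :> R.
  have := adjunction_intersection k a'; rewrite /intersection_opp.
  under [X in _ -> _ - X = _]eq_bigr do rewrite mulrnDl.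
  rewrite big_split /=.
  have -> : \sum_j 1 *+ mult k j = (valency k)%:R :> R by rewrite valencyE natr_sum.
  set s := \sum_j _; rewrite /q !(rmorphD, rmorphM, rmorphN) /=.
  by lra.
have wge0 k : 0 <= 2 * (p k)%:Z - 2 + (e' k)%:Z.
  have [pk|] := posnP (p k); last by have := e'pos k; lia.
  suff : e' k <> 1%N by have := e'pos k; lia.
  by move=> ek; apply: ne1'; exists k.
split=> //; apply: (@negative_definite_of_supersolution _ _ _ (fun k => (n k)%:R + 1)) => //.
  by move=> k; rewrite w ler0z.
apply: contrapT => w0; apply: ndv => k.
have : 2 * (p k)%:Z - 2 + (e' k)%:Z = 0.
  apply: contrapT => /eqP wk; apply: w0; exists k; by rewrite w intr_eq0.
have [pk|] := posnP (p k); last by have := e'pos k; lia.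
by rewrite pk -/e'; lia.
Qed.

End Solutions.

(** * Two-regular graphs *)

Section TwoRegular.
Variable G : multigraph.
Implicit Types (i j : vertex G) (a b : edge G).

Lemma ends_other a i : i \in ends a -> exists2 j, j != i & ends a = [set i; j]%SET.
Proof.
move=> ia; have := card_ends a; rewrite (cardsD1 i) ia => -[/eqP/cards1P[j aj]].
have : j \in (ends a :\ i)%SET by rewrite aj !inE.
rewrite !inE => /andP[ji ja]; exists j => //.
by rewrite -aj finset.setD1K.
Qed.

Lemma ends_neq a i j : ends a = [set i; j]%SET -> i != j.
Proof. by move=> aij; have := card_ends a; rewrite aij cards2; case: eqP. Qed.

Lemma set2_injr i j k : i != j -> [set i; j]%SET = [set i; k]%SET -> j = k.
Proof.
move=> ij /finset.setP/(_ j); rewrite !inE eqxx orbT eq_sym (negPf ij) /=.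
by move/esym/eqP.
Qed.

(** The edges at [i] are sorted by their other end, which is unique. *)
Lemma card_incident i : #|[set a : edge G | i \in ends a]%SET| = valency i.
Proof.
rewrite /valency.
under eq_bigr => j ji do rewrite /mult -sum1_card big_mkcond.
rewrite exchange_big /= -sum1_card big_mkcond /=; apply: eq_bigr => a _.
rewrite inE; case: ifPn => [ia|ia].
  have [j ji aj] := ends_other ia.
  rewrite (bigD1 j) //= inE aj eqxx big1 // => k /andP[ki kj].
  rewrite inE aj; case: eqP => // /set2_injr jk.
  by rewrite jk ?eqxx // in kj; rewrite eq_sym.
rewrite big1 // => j ji; rewrite inE; case: eqP => // aij.
by rewrite aij !inE eqxx in ia.
Qed.

Hypotheses (Gc : connected_graph G) (G2 : forall i, valency i = 2%N).

(** Provides the edge by which a walk arriving through [a] leaves [i]. *)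
Lemma other_edge i a : i \in ends a ->
  exists b, [/\ i \in ends b, b != a &
    forall c, i \in ends c -> c = a \/ c = b].
Proof.
move=> ia; have /eqP/cards2P[b [c [bc bcE]]] := etrans (card_incident i) (G2 i).
have inE' d : (i \in ends d) = (d == b) || (d == c).
  by have /finset.setP/(_ d) := bcE; rewrite !inE.
move: ia; rewrite inE' => /orP[]/eqP ->.
  exists c; rewrite inE' eqxx orbT eq_sym bc; split=> // d.
  by rewrite inE' => /orP[]/eqP; [left|right].
exists b; rewrite inE' eqxx bc; split=> // d.
by rewrite inE' => /orP[]/eqP; [right|left].
Qed.

(** A walk leaves each vertex by the edge it did not arrive through, and is cut at the first
    repeated vertex. The case [n = 2] is a double edge. *)
Lemma two_regular_cycle : vertex G ->
  exists (n : nat) (v : nat -> vertex G) (a : nat -> edge G),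
  [/\ (1 < n)%N /\ v n = v 0%N,
      forall k, (k < n)%N -> ends (a k) = [set v k; v k.+1]%SET,
      (forall k l, (k < n)%N -> (l < n)%N -> v k = v l -> k = l) /\
      (forall k l, (k < n)%N -> (l < n)%N -> a k = a l -> k = l),
      forall i, exists2 k, (k < n)%N & v k = i &
      forall b, exists2 k, (k < n)%N & a k = b].
Proof.
move=> i0.
have [a0 a0P] : exists a0, i0 \in ends a0.
  have := card_incident i0; rewrite G2 => /eqP/cards2P[b [c [bc bcE]]].
  by exists b; have /finset.setP/(_ b) := bcE; rewrite !inE eqxx.
(* A state is a vertex with the edge to follow next; a state whose vertex is not on its edge gets a
   default successor. *)
have next (d : vertex G * edge G) : exists d' : vertex G * edge G,
    d.1 \in ends d.2 ->
    [/\ ends d.2 = [set d.1; d'.1]%SET, d'.1 \in ends d'.2, d'.2 != d.2 &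
     forall c, d'.1 \in ends c -> c = d.2 \/ c = d'.2].
  case: d => i a /=; have [ia|] := boolP (i \in ends a); last by exists (i, a).
  have [j ji aE] := ends_other ia.
  have [|b bP] := @other_edge j a; first by rewrite aE !inE eqxx orbT.
  by exists (j, b) => _ /=; case: bP.
have [f fP] := boolp.choice next.
pose d k := iter k f (i0, a0); pose v k := (d k).1; pose a k := (d k).2.
have va k : v k \in ends (a k).
  by elim: k => // k /fP[].
have aE k : ends (a k) = [set v k; v k.+1]%SET by case: (fP _ (va k)).
have aS k : a k.+1 != a k by case: (fP _ (va k)).
have vS k c : v k.+1 \in ends c -> c = a k \/ c = a k.+1.
  by case: (fP _ (va k)) => _ _ _; apply.
have vneq k : v k != v k.+1 by exact: ends_neq (aE k).
have ex : exists k, [exists l : 'I_k, v l == v k].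
  have /injectivePn[/= x [y xy vxy]] : ~~ injectiveb (fun k : 'I_(#|vertex G|.+1) => v k).
    apply/negP => /injectiveP/leq_card; rewrite card_ord; lia.
  wlog xy' : x y xy vxy / (x < y)%N.
    move=> H; have : (x : nat) != y by [].
    by rewrite neq_ltn => /orP[]; [apply: H|apply: H => //; rewrite eq_sym].
  by exists y; apply/existsP; exists (Ordinal xy'); rewrite vxy.
case: (ex_minnP ex) => n /existsP[[m /= mn] /eqP vmn] nmin.
have vinj k l : (k < n)%N -> (l < n)%N -> v k = v l -> k = l.
  wlog kl : k l / (k <= l)%N.
    move=> H kn ln vkl; case: (leqP k l) => kl; first exact: H.
    by apply/esym/H => //; exact: ltnW.
  move=> kn ln vkl; apply/eqP; rewrite eqn_leq kl leqNgt; apply/negP => kl'.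
  have := nmin l; rewrite leqNgt ln => H; suff : false by []; apply: H.
  by apply/existsP; exists (Ordinal kl'); rewrite vkl.
have [n1|n1] := leqP n 1.
  have m0 : m = 0%N by lia.
  have n1' : n = 1%N by lia.
  by have := vneq 0%N; rewrite -n1' -vmn m0 eqxx.
(* The walk returns to its origin: at [v m] with [0 < m] the two edges are
   already used. *)
have m0 : m = 0%N.
  apply/eqP; case: m mn vmn => // m mn vmn; exfalso.
  have [n' nE] : exists n', n = n'.+1 by exists n.-1; lia.
  have lastE : v m.+1 \in ends (a n') by rewrite vmn aE nE !inE eqxx orbT.
  have vn' : ends (a n') = [set v m.+1; v n']%SET by rewrite aE finset.setUC vmn nE.
  have [am|am] := vS _ _ lastE.
    have nm : n' = m.
      apply: vinj; [lia|lia|].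
      by apply: (set2_injr (ends_neq vn')); rewrite -vn' am aE finset.setUC.
    by lia.
  have vm2 : v n' = v m.+2 by apply: (set2_injr (ends_neq vn')); rewrite -vn' am aE.
  have [m2n|m2n] := ltnP m.+2 n.
    have n'm : n' = m.+2 by apply: vinj => //; lia.
    by have := aS m.+1; rewrite -am n'm eqxx.
  have n'm : n' = m.+1 by lia.
  by have := ends_neq vn'; rewrite n'm eqxx.
subst m.
have [n' nE] : exists n', n = n'.+1 by exists n.-1; lia.
(* The closing edge is not the first one; this matters for [n = 2], where both have the same
   ends. *)
have an' : a n' != a 0%N.
  apply/eqP => an'; have v1 : v 1%N = v n'.
    apply: (set2_injr (vneq 0%N)).
    by rewrite -aE -an' aE -nE -vmn finset.setUC.
  have n'1 : 1%N = n' by apply: vinj => //; lia.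
  by have := aS 0%N; rewrite n'1 an' eqxx.
have an : a n = a 0%N.
  have : v n'.+1 \in ends (a 0%N) by rewrite -nE -vmn va.
  by case/vS => an; [rewrite an eqxx in an'|rewrite nE].
(* The walk uses both edges at every vertex it visits; at [v 0] these are [a n'] and [a 0].
   Connectedness then makes it reach all vertices. *)
have aonto k c : (k < n)%N -> v k \in ends c -> exists2 l, (l < n)%N & a l = c.
  case: k => [_|k kn].
    rewrite vmn nE => /vS[->|->]; first by exists n' => //; rewrite nE.
    by exists 0%N; [lia|rewrite -nE an].
  by case/vS => ->; [exists k => //; lia|exists k.+1].
have vonto i : exists2 k, (k < n)%N & v k = i.
  have /connectP[s + ->] := Gc (v 0%N) i.
  have : exists2 k, (k < n)%N & v k = v 0%N by exists 0%N => //; lia.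
  elim: s (v 0%N) => //= j s IH x [k kn <-] /andP[kj js]; apply: IH js.
  have /card_gt0P[c] := kj; rewrite inE => /eqP cE.
  have [|l ln al] := aonto k c kn; first by rewrite cE !inE eqxx.
  have : j \in ends (a l) by rewrite al cE !inE eqxx orbT.
  rewrite aE !inE => /orP[]/eqP ->; first by exists l.
  have [l1n|nl1] := ltnP l.+1 n; first by exists l.+1.
  by exists 0%N; [lia|rewrite vmn; congr v; lia].
have ainj k l : (k < l)%N -> (l < n)%N -> a k <> a l.
  move=> kl ln akl; have := va k; rewrite akl aE !inE => /orP[]/eqP vk.
    by have := vinj _ _ (ltn_trans kl ln) ln vk; lia.
  have [l1n|nl1] := ltnP l.+1 n.
    by have := vinj _ _ (ltn_trans kl ln) l1n vk; lia.
  have l1 : l.+1 = n by lia.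
  have k0 : k = 0%N by apply: vinj; [lia|lia|rewrite vk l1 vmn].
  by case/eqP: an'; rewrite -k0 akl; congr a; lia.
exists n, v, a; split=> //; first split=> // k l kn ln akl.
  have [kl|lk|//] := ltngtP k l; first by case: (ainj _ _ kl ln).
  by case: (ainj _ _ lk kn).
move=> b; have /set0Pn[i ib] : ends b != finset.set0 by rewrite -card_gt0 card_ends.
by have [k kn vk] := vonto i; apply: (aonto k b kn); rewrite vk.
Qed.

End TwoRegular.

(** * Realizations homeomorphic to the circle *)

(* A continuous map on a compact space to a Hausdorff space is closed. *)
Lemma within_continuous_factor (T X Y : topologicalType) (K : set T)
    (g : T -> X) (c : T -> Y) (f : X -> Y) :
  compact K -> hausdorff_space X -> continuous g -> continuous c ->
  (forall t, K t -> f (g t) = c t) -> {within g @` K, continuous f}.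
Proof.
move=> cK hX cg cc fgc; apply/continuous_closedP => C closedC.
apply/closed_subspaceP; exists (g @` (K `&` c @^-1` C)).
  apply: compact_closed => //; apply: continuous_compact.
    exact: continuous_subspaceT.
  apply: compact_closedI => //; exact: closed_comp closedC.
apply/seteqP; split=> x [].
  move=> [t [Kt Cct] <-] _; split; last by exists t.
  by have : C (f (g t)) by rewrite fgc.
move=> Cfx [t Kt gtx]; split; last by exists t.
exists t => //; split=> //.
by have : C (c t) by rewrite -fgc // gtx.
Qed.


(** Both images are the quotient of [K] by one relation. Each map composes a section of one
    parametrization with the other; equality of fibres makes the result independent of the section.
    [t0] is the default value of the sections outside the images. *)
Lemma homeomorphic_images (T X Y : topologicalType) (K : set T) (t0 : T)
    (g : T -> X) (c : T -> Y) :
  compact K -> hausdorff_space X -> hausdorff_space Y ->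
  continuous g -> continuous c -> 
  (forall s t, K s -> K t -> g s = g t <-> c s = c t) ->
  homeomorphic (g @` K) (c @` K).
Proof.
move=> cK hX hY cg cc gc.
have pre (Z : topologicalType) (h : T -> Z) : exists r : Z -> T,
    forall t, K t -> K (r (h t)) /\ h (r (h t)) = h t.
  have ex z : exists t, (h @` K) z -> K t /\ h t = z.
    have [[t Kt htz]|nz] := pselect ((h @` K) z); first by exists t.
    by exists t0.
  have [r rP] := choice ex; exists r => t Kt.
  by apply: rP; exists t.
have [r rP] := pre _ g; have [r' rP'] := pre _ c.
have cr t : K t -> c (r (g t)) = c t by move=> /[dup] Kt /rP[Kr]; rewrite gc.
have gr t : K t -> g (r' (c t)) = g t by move=> /[dup] Kt /rP'[Kr]; rewrite -gc.
exists (c \o r), (g \o r'); split.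
- split; [exact: (@within_continuous_factor _ _ _ _ g c)|].
  exact: (@within_continuous_factor _ _ _ _ c g).
- by split=> _ [t Kt <-] /=; rewrite ?cr ?gr //; exists t.
- by move=> _ [t Kt <-] /=; rewrite cr // gr.
- by move=> _ [t Kt <-] /=; rewrite gr // cr.
Qed.

Lemma continuous_pair (T U V : topologicalType) (f : T -> U) (g : T -> V) :
  continuous f -> continuous g -> continuous (fun x => (f x, g x)).
Proof. by move=> cf cg x; exact: cvg_pair (cf x) (cg x). Qed.

(** * The circle as an interval with its ends glued *)

Section CircleParametrization.
Variable R : realType.
Implicit Types x y s t : R.

(** The half difference [h] lies in [[0, pi]] and has sine zero, because [cos (h *+ 2) = 1]; so it
    is [0] or [pi]. *)
Lemma cos_sin_inj x y : 0 <= x -> x <= y -> y <= pi *+ 2 ->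
  cos x = cos y -> sin x = sin y -> x = y \/ x = 0 /\ y = pi *+ 2.
Proof.
move=> x0 xy y2 cxy sxy.
pose h := (y - x) / 2.
have hE : h *+ 2 = y - x by rewrite /h -mulr_natr divfK.
have : cos (h *+ 2) = 1 by rewrite hE cosB cxy sxy -!expr2 cos2Dsin2.
rewrite cos_mulr2n cos2sin2 => sh.
have {}sh : sin h ^+ 2 = 0 by lra.
have {}sh : sin h = 0 by apply/eqP; rewrite -sqrf_eq0 sh.
have h0 : 0 <= h by rewrite /h; lra.
have hpi : h <= pi by move: y2; rewrite /h mulr2n; lra.
have : ~~ (0 < h < pi).
  by apply/negP => /sin_gt0_pi; rewrite sh ltxx.
rewrite negb_and -!leNgt => /orP[h0'|hpi']; first by left; rewrite /h in h0'; lra.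
by right; move: y2 hpi'; rewrite /h mulr2n; lra.
Qed.

Lemma cos_sin_surj x y : x ^+ 2 + y ^+ 2 = 1 ->
  exists s, [/\ 0 <= s, s <= pi *+ 2, cos s = x & sin s = y].
Proof.
move=> xy1.
have x11 : -1 <= x <= 1 by apply/andP; split; nra.
have xi : x \in `[(-1), 1] by rewrite in_itv.
have sx : sin (acos x) = `|y|.
  by rewrite sin_acos // -xy1 addrAC subrr add0r sqrtr_sqr.
have := acos_ge0 x11; have := acos_lepi x11 => api a0.
have pi2 : pi *+ 2 = pi + pi :> R by rewrite mulr2n.
have [y0|y0] := leP 0 y.
  exists (acos x); split; rewrite ?acosK ?sx ?ger0_norm // pi2; lra.
exists (pi *+ 2 - acos x).
rewrite cosB sinB cos2pi sin2pi sx acosK // ltr0_norm // pi2.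
by split; lra.
Qed.

(** One turn over [[0, w]]; [w] will be the number of edges of the closed walk, so that both paths
    share their interval. *)
Definition circle_path (w s : R) : R * R :=
  (cos (s / w * (pi *+ 2)), sin (s / w * (pi *+ 2))).

Lemma continuous_circle_path w : continuous (circle_path w).
Proof.
have cm : continuous (fun s : R => s / w * (pi *+ 2)).
  by move=> s; apply: cvgMl; apply: cvgMl; exact: cvg_id.
apply: continuous_pair => s.
  by apply: continuous_comp; [exact: cm|exact: continuous_cos].
by apply: continuous_comp; [exact: cm|exact: continuous_sin].
Qed.

Definition same_fiber w s t := s = t \/ s = 0 /\ t = w \/ s = w /\ t = 0.

Lemma circle_path_fiber w s t : 0 < w -> 0 <= s <= w -> 0 <= t <= w ->
  circle_path w s = circle_path w t <-> same_fiber w s t.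
Proof.
move=> w0; wlog st : s t / s <= t.
  move=> H si ti; case: (leP s t) => [|/ltW] st; first exact: H.
  split=> [/esym/(H _ _ st ti si)|st']; first by rewrite /same_fiber; intuition.
  by apply/esym/(H _ _ st ti si); move: st'; rewrite /same_fiber; intuition.
move=> /andP[s0 sw] /andP[t0 tw]; split.
  case=> cst sst.
  have pi0 : 0 < pi *+ 2 :> R by rewrite mulrn_wgt0 // pi_gt0.
  have inj x y : x / w * (pi *+ 2) = y / w * (pi *+ 2) -> x = y.
    by move/(mulIf (lt0r_neq0 pi0))/(mulIf (invr_neq0 (lt0r_neq0 w0))).
  have [|||/inj|[s0' tw']] := cos_sin_inj _ _ _ cst sst.
  - by apply: mulr_ge0; [apply: divr_ge0 => //|]; exact: ltW.
  - by rewrite ler_pM2r // ler_pM2r // invr_gt0.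
  - by apply: ler_piMl; [exact: ltW|rewrite ler_pdivrMr // mul1r].
  - by left.
  - right; left; split; apply: inj; first by rewrite s0' !mul0r.
    by rewrite tw' divff ?mul1r // gt_eqF.
case=> [->//|[[-> ->]|[-> ->]]].
  by rewrite /circle_path !mul0r divff ?gt_eqF // mul1r cos2pi sin2pi cos0 sin0.
by rewrite /circle_path !mul0r divff ?gt_eqF // mul1r cos2pi sin2pi cos0 sin0.
Qed.

Lemma circle_path_image w : 0 < w -> circle_path w @` `[0, w] = @circle R.
Proof.
move=> w0; apply/seteqP; split=> [_ [s _ <-]|[x y]]; rewrite /circle /=.
  exact: cos2Dsin2.
move=> /cos_sin_surj[s [s0 s2 <- <-]].
have pi0 : 0 < pi *+ 2 :> R by rewrite mulrn_wgt0 // pi_gt0.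
exists (s / (pi *+ 2) * w); first rewrite /= in_itv /=.
  apply/andP; split; first by apply: mulr_ge0; [apply: divr_ge0 => //|]; exact: ltW.
  by apply: ler_piMl; [exact: ltW|rewrite ler_pdivrMr // mul1r].
by rewrite /circle_path mulfK ?gt_eqF // divfK // gt_eqF.
Qed.

End CircleParametrization.

(** * The realization as the image of a closed walk *)

Section ClosedWalk.
Variables (R : realType) (G : multigraph) (n : nat).
Variables (v : nat -> vertex G) (a : nat -> edge G).
Implicit Types (x y s t : R) (b c : edge G) (i j : vertex G).

(* [hat] and [cap] extend by zero the coordinates of [edge_point], so that a walk
   along the edges is a sum of globally continuous functions. *)
Definition hat t : R := Num.max (1 - `|t|) 0.
Definition cap t : R := Num.max (t * (1 - t)) 0.

Lemma continuous_hat_shift (k : nat) : continuous (fun s => hat (s - k%:R)).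
Proof.
move=> s; apply: (@continuous_max _ _ (fun s => 1 - `|s - k%:R|) (fun=> 0));
  last exact: cvg_cst.
apply: cvgB; first exact: cvg_cst.
by apply: cvg_norm; apply: cvgB; [exact: cvg_id|exact: cvg_cst].
Qed.

Lemma continuous_cap_shift (k : nat) : continuous (fun s => cap (s - k%:R)).
Proof.
move=> s.
apply: (@continuous_max _ _ (fun s => (s - k%:R) * (1 - (s - k%:R))) (fun=> 0));
  last exact: cvg_cst.
have cs : {for s, continuous (fun s : R => s - k%:R)}.
  by apply: cvgB; [exact: cvg_id|exact: cvg_cst].
by apply: cvgM => //; apply: cvgB; [exact: cvg_cst|exact: cs].
Qed.

(** Edge [k] is run through during [[k, k + 1]]. The vertex sum has one more term, since the last
    edge needs the hat centred at [n]. *)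
Definition walk_path s : 'rV[R]_#|vertex G| * 'rV[R]_#|edge G| :=
  (\sum_(k < n.+1) hat (s - k%:R) *: delta_mx 0 (enum_rank (v k)),
   \sum_(k < n) cap (s - k%:R) *: delta_mx 0 (enum_rank (a k))).

Lemma continuous_walk_path : continuous walk_path.
Proof.
apply: continuous_pair.
  apply: continuous_big => [|k _ s]; first exact: add_continuous.
  by apply: cvgZr_tmp; exact: continuous_hat_shift.
apply: continuous_big => [|k _ s]; first exact: add_continuous.
by apply: cvgZr_tmp; exact: continuous_cap_shift.
Qed.

(** On [[k, k + 1]] all hats vanish but those centred at [k] and [k + 1], and all caps but the one
    at [k]. *)
Lemma walk_path_edge (k : nat) t : (k < n)%N -> 0 <= t -> t <= 1 ->
  walk_path (k%:R + t) = edge_point (a k) (v k) (v k.+1) t.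
Proof.
move=> kn t0 t1; have shift (l : nat) : k%:R + t - l%:R = t + (k%:R - l%:R) by lra.
have far (l : nat) : (l < k)%N -> k%:R - l%:R >= 1 :> R.
  by move=> lk; have : l.+1%:R <= k%:R :> R; [rewrite ler_nat|rewrite -natr1; lra].
have far' (l : nat) : (k.+1 < l)%N -> k%:R - l%:R <= - 2 :> R.
  move=> kl; have : k.+2%:R <= l%:R :> R by rewrite ler_nat.
  by rewrite -natr1 -natr1; lra.
rewrite /walk_path /edge_point; congr (_, _).
  have k1n : (k.+1 < n.+1)%N by [].
  rewrite (bigD1 (Ordinal (ltnW k1n))) //= (bigD1 (Ordinal k1n)) /=; last first.
    by rewrite -val_eqE /= gtn_eqF.
  rewrite big1 ?addr0 => [|l /andP[lk lk1]].
    congr (_ *: _ + _ *: _); rewrite /hat.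
      by rewrite shift subrr addr0 ger0_norm // max_l // subr_ge0.
    rewrite shift -natr1 ler0_norm; last by lra.
    by rewrite max_l; lra.
  rewrite /hat max_r ?scale0r // shift subr_le0.
  move: lk lk1; rewrite -!val_eqE /= => lk lk1.
  have [/far kl|kl] := ltnP l k; first by rewrite ger0_norm; lra.
  have /far' {}kl : (k.+1 < l)%N by lia.
  by rewrite ler0_norm; lra.
rewrite (bigD1 (Ordinal kn)) //= big1 ?addr0 => [|l lk].
  by congr (_ *: _); rewrite /cap shift subrr addr0 max_l // mulr_ge0 // subr_ge0.
rewrite /cap max_r ?scale0r // shift.
move: lk; rewrite -val_eqE /= => lk.
have [/far kl|kl] := ltnP l k; first by apply: mulr_ge0_le0; lra.
have kl' : k%:R - l%:R <= -1 :> R.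
  have : k.+1%:R <= l%:R :> R by rewrite ler_nat; lia.
  by rewrite -natr1; lra.
by apply: mulr_le0_ge0; lra.
Qed.

Lemma edge_point0 b i j : @edge_point R G b i j 0 = vertex_point R i.
Proof. by rewrite /edge_point subr0 scale1r !scale0r addr0 mul0r scale0r. Qed.

Lemma edge_point1 b i j : @edge_point R G b i j 1 = vertex_point R j.
Proof. by rewrite /edge_point subrr scale0r scale1r add0r mulr0 scale0r. Qed.

Lemma edge_pointC b i j t : @edge_point R G b i j (1 - t) = edge_point b j i t.
Proof. by rewrite /edge_point subKr addrC [(1 - t) * t]mulrC. Qed.

Lemma vertex_point_inj : injective (@vertex_point R G).
Proof.
move=> i j [/matrixP/(_ 0 (enum_rank i))].
rewrite !mxE !eqxx /= => /esym.
by have [/enum_rank_inj //|_ /eqP] := eqVneq; rewrite eq_sym oner_eq0.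
Qed.

(** The coordinate [x * (1 - x)] is positive and singles out the edge; [x] itself is the coordinate
    at the vertex [j]. *)
Lemma edge_point_inj b c i j i' j' x y : i != j -> i' != j' ->
  0 < x < 1 -> edge_point b i j x = edge_point c i' j' y ->
  b = c /\ (i = i' -> j = j' -> x = y).
Proof.
move=> ij i'j' /andP[x0 x1] [/matrixP E1 /matrixP/(_ 0 (enum_rank b))].
rewrite !mxE !eqxx /= mulr1 => xy; split=> [|ii jj].
  apply: contrapT => bc; move: xy.
  have [/enum_rank_inj //|_] := eqVneq (enum_rank b); rewrite mulr0 => /eqP.
  by rewrite mulf_eq0 subr_eq0 !gt_eqF.
subst i' j'; have := E1 0 (enum_rank j); rewrite !mxE !eqxx /=.
have [/enum_rank_inj ji|_] := eqVneq (enum_rank j); first by rewrite ji eqxx in ij.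
by rewrite !mulr0 !add0r !mulr1.
Qed.

Hypotheses (n1 : (1 < n)%N) (vn : v n = v 0%N).
Hypothesis aE : forall k, (k < n)%N -> ends (a k) = [set v k; v k.+1]%SET.
Hypothesis vinj : forall k l, (k < n)%N -> (l < n)%N -> v k = v l -> k = l.
Hypothesis ainj : forall k l, (k < n)%N -> (l < n)%N -> a k = a l -> k = l.

Lemma walk_decomposition s : 0 <= s <= n%:R ->
  exists k t, [/\ (k < n)%N, 0 <= t, t <= 1 & s = k%:R + t].
Proof.
move=> /andP[s0 sn]; have [s_n|s_n] := ltP s n%:R.
  have /andP[ks sk] := truncn_itv s0.
  exists (Num.truncn s), (s - (Num.truncn s)%:R); split; [|lra| |lra].
    by rewrite -(ltr_nat R) (le_lt_trans ks).
  by move: sk; rewrite -natr1; lra.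
have n0 := ltnW n1.
(* The endpoint [s = n] is taken as the end of the last edge, as [n] is no edge index. *)
exists n.-1, 1; split=> //; first by rewrite ltn_predL.
by rewrite natr1 prednK //; apply/eqP; rewrite eq_le sn.
Qed.

Lemma walk_path_nat k : (k <= n)%N -> walk_path k%:R = vertex_point R (v k).
Proof.
rewrite leq_eqVlt => /predU1P[->|kn]; last first.
  by rewrite -[k%:R]addr0 walk_path_edge // edge_point0.
have n0 := ltnW n1.
rewrite -[in LHS](prednK n0) -natr1 walk_path_edge ?ltn_predL //.
by rewrite edge_point1 prednK.
Qed.

(** Interior points of edges determine their parameter. The other parameters are integers and give
    vertices, where only [0] and [n] collide. *)
Lemma walk_path_fiber s t : 0 <= s <= n%:R -> 0 <= t <= n%:R ->
  walk_path s = walk_path t <-> same_fiber n%:R s t.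
Proof.
move=> si ti; split; last first.
  by case=> [->//|[[-> ->]|[-> ->]]]; rewrite -[0]/(0%:R) !walk_path_nat // vn.
have [k [x [kn x0 x1 sE]]] := walk_decomposition si.
have [l [y [ln y0 y1 tE]]] := walk_decomposition ti.
have interior k' l' x' y' : (k' < n)%N -> (l' < n)%N -> 0 < x' < 1 ->
    edge_point (a k') (v k') (v k'.+1) x' = edge_point (a l') (v l') (v l'.+1) y' ->
    k'%:R + x' = l'%:R + y'.
  move=> k'n l'n x'i.
  case/(edge_point_inj (ends_neq (aE k'n)) (ends_neq (aE l'n)) x'i).
  by move=> /ainj -/(_ k'n l'n) <- ->.
have integral k' x' : (k' < n)%N -> 0 <= x' -> x' <= 1 -> ~~ (0 < x' < 1) ->
    exists2 m, (m <= n)%N & k'%:R + x' = m%:R.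
  move=> k'n x'0 x'1; rewrite negb_and -!leNgt => /orP[x'i|x'i].
    by exists k'; [exact: ltnW|lra].
  by exists k'.+1 => //; rewrite -natr1; lra.
rewrite sE tE; have [xi|xi] := boolP (0 < x < 1).
  by rewrite !walk_path_edge // => /(interior _ _ _ _ kn ln xi) ->; left.
have [yi|yi] := boolP (0 < y < 1).
  by rewrite !walk_path_edge // => /esym/(interior _ _ _ _ ln kn yi) ->; left.
have [m mn ->] := integral _ _ kn x0 x1 xi.
have [m' m'n ->] := integral _ _ ln y0 y1 yi.
rewrite !walk_path_nat // => /vertex_point_inj.
have [mn'|nm] := ltnP m n; have [m'n'|nm'] := ltnP m' n.
- by move=> /(vinj mn' m'n') ->; left.
- have -> : m' = n by apply/eqP; rewrite eqn_leq m'n.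
  by rewrite vn => /(vinj mn' (ltnW n1)) ->; right; left.
- have -> : m = n by apply/eqP; rewrite eqn_leq mn.
  by rewrite vn => /(vinj (ltnW n1) m'n') <-; right; right.
- have -> : m = n by apply/eqP; rewrite eqn_leq mn.
  by have -> : m' = n by [apply/eqP; rewrite eqn_leq m'n]; left.
Qed.

Lemma walk_path_image : (forall i, exists2 k, (k < n)%N & v k = i) ->
  (forall b, exists2 k, (k < n)%N & a k = b) ->
  walk_path @` `[0, n%:R] = @realization R G.
Proof.
move=> vonto aonto; apply/seteqP; split=> [_ [s + <-]|z].
  rewrite /= in_itv /= => /walk_decomposition[k [t [kn t0 t1 ->]]].
  right; exists (a k), (v k), (v k.+1), t; split=> //; first exact: aE.
  exact: walk_path_edge.
have itv k t : (k < n)%N -> 0 <= t -> t <= 1 -> `[0, n%:R]%classic (k%:R + t).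
  move=> kn t0 t1; rewrite /= in_itv /= addr_ge0 //=.
  have : k.+1%:R <= n%:R :> R by rewrite ler_nat.
  by rewrite -natr1; lra.
case=> [[i ->]|[b [i [j [t [bE t0 t1 ->]]]]]].
  have [k kn <-] := vonto i; exists (k%:R + 0); first exact: itv.
  by rewrite addr0 walk_path_nat // ltnW.
have [k kn akb] := aonto b; move: bE; rewrite -akb aE // => vE.
have vk := ends_neq (aE kn).
have : v k \in [set i; j]%SET by rewrite -vE !inE eqxx.
rewrite !inE => /orP[]/eqP vki.
  exists (k%:R + t); first exact: itv.
  rewrite walk_path_edge // vki; congr edge_point.
  by apply: (set2_injr vk); rewrite vE vki.
(* Here the walk follows the edge from [j] to [i], so the parameter is reversed. *)
exists (k%:R + (1 - t)); first by apply: itv => //; lra.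
rewrite walk_path_edge //; [|lra|lra].
rewrite edge_pointC vki; congr (edge_point _ _ _ _).
by apply: (set2_injr vk); rewrite vE vki finset.setUC.
Qed.

End ClosedWalk.

(** Both spaces are images of [[0, n]] under paths that glue exactly its two ends. *)
Lemma two_regular_circle (R : realType) (G : multigraph) : vertex G ->
  connected_graph G -> (forall i : vertex G, valency i = 2%N) ->
  homeomorphic (@realization R G) (@circle R).
Proof.
move=> i0 Gc G2.
have [n [v [a [[n1 vn] aE [vinj ainj] vonto aonto]]]] := two_regular_cycle Gc G2 i0.
have n0 : 0 < n%:R :> R by rewrite ltr0n ltnW.
rewrite -(walk_path_image R n1 aE vonto aonto) -(circle_path_image n0).
apply: (@homeomorphic_images _ _ _ _ 0).
- exact: segment_compact.
- exact: norm_hausdorff.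
- exact: norm_hausdorff.
- exact: continuous_walk_path.
- exact: continuous_circle_path.
move=> s t; rewrite /= !in_itv /= => si ti.
by rewrite (walk_path_fiber n1 vn aE vinj ainj) // circle_path_fiber.
Qed.

(** * Finiteness of the self-intersection numbers *)

Theorem proposition5p2 (R : realType) (G : multigraph) (p : vertex G -> nat)
    (Gconn : connected_graph G) (Gncusp : ~ cusp_graph R p) (i : vertex G) :
  ((1 < valency i)%N -> finite_set (e_values R p i)) /\
  (valency i = 1%N ->
    (infinite_set (e_values R p i) <->
       exists n e : vertex G -> nat, solution R p n e /\ n i = 0%N) /\
    (* The excluded weights make the form degenerate: with them the claim fails
       for affine Dynkin diagrams. *)
    (forall n e : vertex G -> nat, solution R p n e -> n i = 0%N ->
       forall m : nat, (0 < m)%N -> m <> 1%N ->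
         ~ du_val_weights p (update e i m) ->
         solution R p n (update e i m))).
Proof.
have update_inf n e : solution R p n e -> n i = 0%N -> infinite_set (e_values R p i).
  move=> sol ni fin.
  (* Starting at 3 avoids the value 2, the only one at which the new weights could be Du Val
     weights. *)
  have sub : [set m | (2 < m)%N] `<=` e_values R p i.
    move=> m /= m2; exists n, (update e i m); split; last by rewrite /update eqxx.
    apply: solution_update => //; first exact: ltnW.
    by move=> /(_ i)[_]; rewrite /update eqxx => mE; rewrite mE in m2.
  apply: infinite_nat; apply: (@sub_finite_set _ _ (`I_3 `|` e_values R p i)).
    by move=> m _; have [m3|m3] := ltnP m 3; [left|right; exact: sub].
  by rewrite finite_setU; split=> //; exact: finite_II.
split=> [vi|vi].
  apply: contrapT => /infinite_e_values_zero[n [e [[_ a _ _] ni]]].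
  have two := zero_coefficient Gconn a ni vi.
  apply: Gncusp; split=> [|j]; last by have [] := two j.
  by apply: two_regular_circle => // j; have [] := two j.
split.
  split; first exact: infinite_e_values_zero.
  by case=> n [e [sol ni]]; exact: update_inf sol ni.
move=> n e sol ni m m0 m1 ndv; apply: solution_update => //.
by move: m0 m1; case: m {ndv} => [|[|]].
Qed.
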